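(* Let $F$ be a field, and let $F(x)$ be the field of rational functions in $x$ over $F$. Let $G$ be any finite subgroup of $PGL(2,F)$. Assume that $G$ is not a subgroup of $PGL(2,K)$ for any proper subfield $K$ of $F$. Let $f(x)/g(x)$, with $f,g\in F[x]$ relatively prime and one of $f,g$ monic, be a nonconstant coefficient of the orbit polynomial $P_G(T)$ of $G$. Let $H$ be a nontrivial finite group of automorphisms of $F$, with fixed field $E$. Then $H$ fixes $G$ if and only if $f$ and $g$ have coefficients in $E$.
   Context: Elements of $PGL(2,F)$ are written as linear fractional transformations $s(x)=\frac{ax+b}{cx+d}$ with $a,b,c,d\in F$, $ad-bc\neq0$. The orbit polynomial of $G$ is $P_G(T)=\prod_{s\in G}(T-s(x))\in F(x)[T]$; a coefficient is nonconstant if it is not in $F$. ''$G$ is defined over the subfield $K$ of $F$'' means: for each $s\in G$, $s(x)=(ax+b)/(cx+d)$, there is a nonzero $e\in\{a,b,c,d\}$ such that $a/e,b/e,c/e,d/e$ all lie in $K$. ''$G$ is not a subgroup of $PGL(2,K)$ for any proper subfield $K$ of $F$'' means that $G$ is not defined over any proper subfield $K$ of $F$. For $\sigma\in H$ and $s(x)=\frac{ax+b}{cx+d}$ in $PGL(2,F)$, put $\sigma.s(x)=\frac{\sigma(a)x+\sigma(b)}{\sigma(c)x+\sigma(d)}$, and $\sigma.G=\{\sigma.s: s\in G\}$. ''$H$ fixes $G$'' means $\sigma.G=G$ for all $\sigma\in H$. *)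

(* Defs.v *)
From HB Require Import structures.
From mathcomp Require Import all_boot all_algebra finmap generic_quotient.
From mathcomp Require Import boolp classical_sets cardinality.
Set Implicit Arguments. Unset Strict Implicit. Unset Printing Implicit Defensive.
Import GRing.Theory.
Local Open Scope ring_scope.
Local Open Scope quotient_scope.

Section PGL2.
Variable F : fieldType.

Definition GL2 := {A : 'M[F]_2 | A \in unitmx}.
Implicit Types A B C : GL2.

Definition gl_one : GL2 := exist _ 1%:M (@unitmx1 F 2).

Fact gl_mul_subproof A B : val A *m val B \in unitmx.
Proof. by rewrite unitmx_mul (valP A) (valP B). Qed.
Definition gl_mul A B : GL2 := exist _ (val A *m val B) (gl_mul_subproof A B).

Fact gl_inv_subproof A : invmx (val A) \in unitmx.
Proof. by rewrite unitmx_inv (valP A). Qed.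
Definition gl_inv A : GL2 := exist _ (invmx (val A)) (gl_inv_subproof A).

Definition proj_equiv : rel GL2 :=
  fun A B => `[< exists2 c : F, c != 0 & val A = c *: val B >].

Fact proj_equiv_refl : reflexive proj_equiv.
Proof. by move=> A; apply/asboolP; exists 1; rewrite ?oner_neq0 ?scale1r. Qed.

Fact proj_equiv_impl A B : proj_equiv A B -> proj_equiv B A.
Proof.
move=> /asboolP[c c0 AB]; apply/asboolP; exists c^-1; first by rewrite invr_eq0.
by rewrite AB scalerA mulVf // scale1r.
Qed.

Fact proj_equiv_sym : symmetric proj_equiv.
Proof. by move=> A B; apply/idP/idP; exact: proj_equiv_impl. Qed.

Fact proj_equiv_trans : transitive proj_equiv.
Proof.
move=> B A C /asboolP[c c0 AB] /asboolP[d d0 BC]; apply/asboolP.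
by exists (c * d); rewrite ?mulf_neq0 // AB BC scalerA.
Qed.

Canonical proj_equiv_equiv :=
  EquivRel proj_equiv proj_equiv_refl proj_equiv_sym proj_equiv_trans.

Definition PGL2 := {eq_quot proj_equiv}.
HB.instance Definition _ := Choice.on PGL2.
HB.instance Definition _ := EqQuotient.on PGL2.

Definition pgl (A : GL2) : PGL2 := \pi_PGL2 A.

Lemma pglP A B :
  reflect (exists2 c : F, c != 0 & val A = c *: val B) (pgl A == pgl B).
Proof. by rewrite /pgl eqmodE; apply: asboolP. Qed.

Lemma pgl_reprK (s : PGL2) : pgl (repr s) = s.
Proof. exact: reprK. Qed.

Lemma repr_pgl A : exists2 c : F, c != 0 & val (repr (pgl A)) = c *: val A.
Proof. by apply/pglP; rewrite pgl_reprK. Qed.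

Definition pgl_one : PGL2 := pgl gl_one.
Definition pgl_mul (s t : PGL2) : PGL2 := pgl (gl_mul (repr s) (repr t)).
Definition pgl_inv (s : PGL2) : PGL2 := pgl (gl_inv (repr s)).

Lemma pgl_mulE A B : pgl_mul (pgl A) (pgl B) = pgl (gl_mul A B).
Proof.
have [c c0 Ac] := repr_pgl A; have [d d0 Bd] := repr_pgl B.
apply/eqP/pglP; exists (c * d); first exact: mulf_neq0.
by rewrite /= Ac Bd -scalemxAl -scalemxAr scalerA.
Qed.

Lemma pgl_invE A : pgl_inv (pgl A) = pgl (gl_inv A).
Proof.
have [c c0 Ac] := repr_pgl A.
apply/eqP/pglP; exists c^-1; first by rewrite invr_eq0.
by rewrite /= Ac invmxZ // -Ac (valP (repr (pgl A))).
Qed.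

Fact pgl_mulA : associative pgl_mul.
Proof.
move=> s t u; rewrite -(pgl_reprK s) -(pgl_reprK t) -(pgl_reprK u) !pgl_mulE.
by congr pgl; apply/val_inj; rewrite /= mulmxA.
Qed.

Fact pgl_mul1 : left_id pgl_one pgl_mul.
Proof.
move=> s; rewrite -(pgl_reprK s) pgl_mulE.
by congr pgl; apply/val_inj; rewrite /= mul1mx.
Qed.

Fact pgl_mulr1 : right_id pgl_one pgl_mul.
Proof.
move=> s; rewrite -(pgl_reprK s) pgl_mulE.
by congr pgl; apply/val_inj; rewrite /= mulmx1.
Qed.

Fact pgl_mulV : left_inverse pgl_one pgl_inv pgl_mul.
Proof.
move=> s; rewrite -(pgl_reprK s) pgl_invE pgl_mulE.
by congr pgl; apply/val_inj; rewrite /= mulVmx // (valP (repr s)).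
Qed.

Fact pgl_mulrV : right_inverse pgl_one pgl_inv pgl_mul.
Proof.
move=> s; rewrite -(pgl_reprK s) pgl_invE pgl_mulE.
by congr pgl; apply/val_inj; rewrite /= mulmxV // (valP (repr s)).
Qed.

HB.instance Definition _ :=
  isGroup.Build PGL2 pgl_mulA pgl_mul1 pgl_mulr1 pgl_mulV pgl_mulrV.

Definition mx_lft (A : 'M[F]_2) : {fraction {poly F}} :=
  tofrac ((A 0 0)%:P * 'X + (A 0 1)%:P) / tofrac ((A 1 0)%:P * 'X + (A 1 1)%:P).

(* The element s(x) of F(x). *)
Definition lft (s : PGL2) : {fraction {poly F}} := mx_lft (val (repr s)).

Lemma lftE A : lft (pgl A) = mx_lft (val A).
Proof.
have [c c0 Ac] := repr_pgl A; rewrite /lft Ac /mx_lft !mxE.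
have cF0 : tofrac c%:P != 0.
  by rewrite tofrac_eq0 polyC_eq0.
by rewrite !polyCM -!mulrA -!mulrDr !tofracM -mulf_div divff // mul1r.
Qed.

Definition orbit_poly (G : {fset PGL2}) : {poly {fraction {poly F}}} :=
  \prod_(s <- G) ('X - (lft s)%:P).

(* Any matrix [A] of [s] will do: the condition is invariant under scaling. *)
Definition defined_over (K : {pred F}) (G : {fset PGL2}) : Prop :=
  forall A : GL2, pgl A \in G ->
    exists i j, val A i j != 0 /\ forall k l, val A k l / val A i j \in K.

Fact gl_map_subproof (sigma : {rmorphism F -> F}) A :
  map_mx sigma (val A) \in unitmx.
Proof. by rewrite map_unitmx (valP A). Qed.
Definition gl_map (sigma : {rmorphism F -> F}) A : GL2 :=
  exist _ (map_mx sigma (val A)) (gl_map_subproof sigma A).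

Definition pgl_map (sigma : {rmorphism F -> F}) (s : PGL2) : PGL2 :=
  pgl (gl_map sigma (repr s)).

Lemma pgl_mapE sigma A : pgl_map sigma (pgl A) = pgl (gl_map sigma A).
Proof.
have [c c0 Ac] := repr_pgl A.
apply/eqP/pglP; exists (sigma c); first by rewrite fmorph_eq0.
by rewrite /= Ac map_mxZ.
Qed.

(* Closure under inverses makes the members of [H] automorphisms. *)
Record finite_autgroup (H : set {rmorphism F -> F}) : Prop := FiniteAutgroup {
  autgroup_finite : finite_set H;
  autgroup_id : H (idfun : {rmorphism F -> F});
  autgroup_comp : forall sigma tau : {rmorphism F -> F},
    H sigma -> H tau -> H (sigma \o tau : {rmorphism F -> F});
  autgroup_inv : forall sigma, H sigma ->
    exists2 tau : {rmorphism F -> F}, H tau & cancel sigma tau /\ cancel tau sigma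
}.

Definition fixed_field (H : set {rmorphism F -> F}) : {pred F} :=
  [pred a | `[< forall sigma, H sigma -> sigma a = a >]].

Definition autgroup_fixes (H : set {rmorphism F -> F}) (G : {fset PGL2}) : Prop :=
  forall sigma, H sigma -> [fset pgl_map sigma s | s in G]%fset = G.

End PGL2.

(* Main.v *)
Require Import Defs.
From mathcomp Require Import all_boot all_algebra finmap.
From mathcomp Require Import boolp classical_sets.
From HB Require Import structures.
From mathcomp Require Import generic_quotient ring.
Set Implicit Arguments. Unset Strict Implicit. Unset Printing Implicit Defensive.
Import GRing.Theory.
Local Open Scope ring_scope.

(** Write n = #|G| and let u = f / g be the given nonconstant coefficient of
    P_G(T).  For t in PGL(2,F), substituting t(x) for x is an endomorphism of
    F(x) that sends s(x) to (s t)(x).  For t in G it permutes the roots of P_G,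
    hence fixes u; so f(t(x)) = u g(t(x)), which says that t(x) is a root of
<<
      R(T) = f(T) - u g(T)   in F(x)[T]
>>
    ([horner_lft_mem]).  Clearing the denominators of the s(x), each coefficient
    of P_G is a quotient of polynomials in x of degree at most n, so f and g have
    degree at most n ([orbit_coef_size]), and so has R, which is nonzero because
    u is not constant.  As the s(x) are pairwise distinct, the n roots coming
    from G are all the roots of R: an element t of PGL(2,F) lies in G as soon as
    t(x) is a root of R ([mem_of_horner_lft]).

    An endomorphism sigma of F, acting on the coefficients of rational functions,
    sends s(x) to (sigma.s)(x), hence P_G to P_(sigma.G) ([orbit_poly_map]).

    If sigma.G = G, this action fixes u, so sigma(f)/sigma(g) = f/g, and
    coprimality together with the monic normalization forces sigma(f) = f and
    sigma(g) = g ([map_poly_fixed_of_cross]).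

    Conversely, if sigma fixes f and g, it fixes u and R, so it maps the root
    s(x) of R, for s in G, to the root (sigma.s)(x); therefore sigma.s is in G.
    Thus sigma.G is contained in G, and they have the same cardinality. *)

(** * Extending morphisms to fields of fractions *)

Lemma fraction_repr (R : idomainType) (x : {fraction R}) :
  x = tofrac \n_(repr x) / tofrac \d_(repr x).
Proof.
have d0 : \d_(repr x) != 0 by apply: denom_ratioP.
apply: (canRL (mulfK _)); first by rewrite tofrac_eq0.
rewrite -{1}[x]reprK; unlock FracField.tofrac.
rewrite -[LHS]FracField.pi_mul; apply/eqmodP; rewrite /= FracField.equivfE.
by rewrite /FracField.mulf !numden_Ratio ?mulf_neq0 ?oner_eq0 // !mulr1 mulrC.
Qed.

(** The universal property of the field of fractions.  Both endomorphisms of F(x)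
    that the proof uses, the substitution of t(x) for x and the action of sigma on
    coefficients, are obtained by extending an injective morphism from F[x]. *)
Lemma fraction_extension (R : idomainType) (K : fieldType)
    (phi : {rmorphism R -> K}) : injective phi ->
  exists psi : {rmorphism {fraction R} -> K}, forall r, psi (tofrac r) = phi r.
Proof.
move=> phi_inj.
have phi_eq0 p : (phi p == 0) = (p == 0) by rewrite -(inj_eq phi_inj) rmorph0.
have fracP (x : {fraction R}) :
    exists p q : R, q != 0 /\ x = tofrac p / tofrac q.
  exists \n_(repr x), \d_(repr x); split; last exact: fraction_repr.
  exact: denom_ratioP.
pose psi0 (x : {fraction R}) : K := phi \n_(repr x) / phi \d_(repr x).
(* The representative chosen by the quotient is arbitrary; injectivity of phi is
   what makes the value independent of it. *)
have psiE p q : q != 0 -> psi0 (tofrac p / tofrac q) = phi p / phi q.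
  move=> q0; set x := _ / _.
  have d0 : \d_(repr x) != 0 by apply: denom_ratioP.
  apply/eqP; rewrite eqr_div ?phi_eq0 // -!rmorphM (inj_eq phi_inj).
  by rewrite -tofrac_eq !tofracM -eqr_div ?tofrac_eq0 // -fraction_repr.
have psi_add : zmod_morphism psi0.
  move=> x y; have [p [q [q0 ->]]] := fracP x.
  have [p' [q' [q'0 ->]]] := fracP y.
  rewrite -mulNr -tofracN addf_div ?tofrac_eq0 // -!tofracM -tofracD.
  rewrite !psiE ?mulf_neq0 // -mulNr -rmorphN addf_div ?phi_eq0 //.
  by rewrite -!rmorphM -rmorphD.
have psi_mul : monoid_morphism psi0.
  split=> [|x y].
    by rewrite -[1]divr1 -tofrac1 psiE ?oner_eq0 // rmorph1 divr1.
  have [p [q [q0 ->]]] := fracP x; have [p' [q' [q'0 ->]]] := fracP y.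
  by rewrite mulf_div -!tofracM !psiE ?mulf_neq0 // mulf_div -!rmorphM.
pose psi : {rmorphism {fraction R} -> K} := HB.pack psi0
  (GRing.isZmodMorphism.Build _ _ psi0 psi_add)
  (GRing.isMonoidMorphism.Build _ _ psi0 psi_mul).
exists psi => r; rewrite /psi /=.
by rewrite -[tofrac r]divr1 -tofrac1 psiE ?oner_eq0 // rmorph1 divr1.
Qed.

(** * Substitutions in rational functions *)

Section RationalFunctions.
Variable F : fieldType.
Local Notation Fx := {fraction {poly F}}.

Definition cst : {rmorphism F -> Fx} := (@FracField.tofrac _) \o polyC.
Definition var : Fx := tofrac 'X.

(** Polynomials over F are viewed in F(x)[T] through [cst], so that evaluating at
    an element y of F(x) is the substitution of y for x. *)
Lemma horner_cst_var (p : {poly F}) : (map_poly cst p).[var] = tofrac p.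
Proof.
have -> : map_poly cst p = map_poly (@FracField.tofrac _) (map_poly polyC p).
  by rewrite -map_poly_comp.
by rewrite horner_map /= -/(comp_poly 'X p) comp_polyXr.
Qed.

Lemma var_transcendental : ~ algebraicOver cst var.
Proof.
by case=> p p0 /rootP; rewrite horner_cst_var => /eqP; rewrite tofrac_eq0 (negPf p0).
Qed.

(** Substituting y for x is injective on F[x] exactly when y is transcendental
    over F, and then it extends to F(x). *)
Lemma substitution_exists (y : Fx) : ~ algebraicOver cst y ->
  exists Phi : {rmorphism Fx -> Fx},
    (forall c, Phi (cst c) = cst c) /\ Phi var = y.
Proof.
move=> y_tr.
pose phi : {rmorphism {poly F} -> Fx} := horner_eval y \o map_poly cst.
have phi_inj : injective phi.
  apply: raddf_inj => p /eqP py0; apply/eqP/negPn/negP => p0.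
  by apply: y_tr; exists p.
have [Phi PhiE] := fraction_extension phi_inj.
exists Phi; split=> [c|]; first by rewrite PhiE /phi /= /horner_eval map_polyC hornerC.
by rewrite PhiE /phi /= /horner_eval map_polyX hornerX.
Qed.

Lemma coef_action_exists (sigma : {rmorphism F -> F}) :
  exists Psi : {rmorphism Fx -> Fx},
    forall p, Psi (tofrac p) = tofrac (map_poly sigma p).
Proof.
pose phi : {rmorphism {poly F} -> Fx} := (@FracField.tofrac _) \o map_poly sigma.
apply: (@fraction_extension _ _ phi) => p q /eqP.
by rewrite /phi /= tofrac_eq => /eqP /map_poly_inj.
Qed.

Lemma mx_lftE (A : 'M[F]_2) : mx_lft A =
  (cst (A 0 0) * var + cst (A 0 1)) / (cst (A 1 0) * var + cst (A 1 1)).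
Proof. by rewrite /mx_lft !tofracD !tofracM. Qed.

Lemma det_mx2 (A : 'M[F]_2) : \det A = A 0 0 * A 1 1 - A 0 1 * A 1 0.
Proof.
rewrite (expand_det_row _ 0) !big_ord_recl big_ord0 addr0 /cofactor !det_mx11.
rewrite !mxE /= !(expr0, expr1) mul1r mulN1r mulrN.
by congr (A _ _ * A _ _ - A _ _ * A _ _); apply/val_inj.
Qed.

Lemma GL2_det_neq0 (A : GL2 F) :
  val A 0 0 * val A 1 1 - val A 0 1 * val A 1 0 != 0.
Proof. by rewrite -det_mx2 -unitfE; have := valP A; rewrite unitmxE. Qed.

Lemma cst_var_eq0 a b : (cst a * var + cst b == 0) = (a == 0) && (b == 0).
Proof.
rewrite -[X in _ == X]tofrac0 -tofracM -tofracD tofrac_eq -size_poly_eq0.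
by rewrite size_MXaddC polyC_eq0; case: ifP.
Qed.

Lemma den_neq0 (A : GL2 F) : cst (val A 1 0) * var + cst (val A 1 1) != 0.
Proof.
rewrite cst_var_eq0; apply/negP => /andP[/eqP c0 /eqP d0].
by have := GL2_det_neq0 A; rewrite c0 d0 !mulr0 subrr eqxx.
Qed.

(** If t(x) were algebraic over F, so would be x, which is the image of t(x) under
    the inverse transformation (d y - b) / (a - c y). *)
Lemma lft_transcendental (t : PGL2 F) : ~ algebraicOver cst (lft t).
Proof.
rewrite -(pgl_reprK t) lftE mx_lftE; set A := repr t.
move: (den_neq0 A) (GL2_det_neq0 A).
move: (val A 0 0) (val A 0 1) (val A 1 0) (val A 1 1) => a b c d.
set D := _ + _ => D0 det0; set y := _ / _ => y_alg.
have yD : y * D = cst a * var + cst b by rewrite /y divfK.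
have det_cst0 : cst (a * d - b * c) != 0 by rewrite fmorph_eq0.
(* Multiplying by the denominator D of t(x) turns the numerator and the
   denominator of the inverse transformation into det * x and det. *)
have num_eq : (cst d * y - cst b) * D = cst (a * d - b * c) * var.
  by rewrite mulrBl -mulrA yD /D !(rmorphB, rmorphM) /=; ring.
have den_eq : (cst a - cst c * y) * D = cst (a * d - b * c).
  by rewrite mulrBl -mulrA yD /D !(rmorphB, rmorphM) /=; ring.
apply: var_transcendental.
have -> : var = (cst d * y - cst b) / (cst a - cst c * y).
  have den0 : cst a - cst c * y != 0.
    by apply: contra_neq det_cst0 => den0; rewrite -den_eq den0 mul0r.
  apply: (canRL (mulfK den0)); apply: (mulIf D0).
  by rewrite -mulrA den_eq num_eq mulrC.
have cst_alg e : algebraicOver cst (cst e) by exact: algebraic_id.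
apply: algebraic_div.
  exact: algebraic_sub (algebraic_mul (cst_alg d) y_alg) (cst_alg b).
exact: algebraic_sub (cst_alg a) (algebraic_mul (cst_alg c) y_alg).
Qed.

(** The substitution of t(x) for x acts by right translation, since s(t(x)) is
    the composite (s t)(x). *)
Lemma subst_lft (Phi : {rmorphism Fx -> Fx}) (s t : PGL2 F) :
  (forall c, Phi (cst c) = cst c) -> Phi var = lft t ->
  Phi (lft s) = lft (s * t)%g.
Proof.
move=> Phi_cst; rewrite -(pgl_reprK s) -(pgl_reprK t).
move: (repr s) (repr t) => A B Phi_var.
have -> : (pgl A * pgl B)%g = pgl (gl_mul A B) by exact: pgl_mulE.
have D0 := den_neq0 B.
have yD : Phi var * (cst (val B 1 0) * var + cst (val B 1 1)) =
    cst (val B 0 0) * var + cst (val B 0 1).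
  by rewrite Phi_var lftE mx_lftE divfK.
rewrite !lftE !mx_lftE fmorph_div !(rmorphD Phi) !(rmorphM Phi) !Phi_cst.
(* Expand the fraction s(t(x)) by the denominator of t(x). *)
rewrite -[LHS]mulr1 -(divff D0) mulf_div.
rewrite !(mulrDl (cst _ * Phi var)) -!(mulrA _ (Phi var)) yD.
have mulE i j : val (gl_mul A B) i j = val A i 0 * val B 0 j + val A i 1 * val B 1 j.
  rewrite mxE !big_ord_recl big_ord0 addr0.
  by have -> : lift (0 : 'I_2) (0 : 'I_1) = 1 by apply/val_inj.
by rewrite !mulE !(rmorphD cst) !(rmorphM cst); congr (_ / _); ring.
Qed.

Lemma substitution_lft_exists (t : PGL2 F) :
  exists Phi : {rmorphism Fx -> Fx},
    [/\ forall c, Phi (cst c) = cst c, Phi var = lft t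
      & forall s, Phi (lft s) = lft (s * t)%g].
Proof.
have [Phi [Phi_cst Phi_var]] := substitution_exists (@lft_transcendental t).
by exists Phi; split=> // s; apply: subst_lft.
Qed.

Lemma lft_eq_var (s : PGL2 F) : lft s = var -> s = 1%g.
Proof.
rewrite -(pgl_reprK s) lftE mx_lftE; move: (repr s) => A.
move/(canRL (divfK (den_neq0 A))).
(* Compare the coefficients of a X + b = X (c X + d): b = 0, a = d and c = 0. *)
rewrite mulrDr mulrCA -!tofracM -!tofracD => /eqP; rewrite tofrac_eq /=.
move=> /eqP/polyP E; have coef_eq k : ((val A 0 0)%:P * 'X + (val A 0 1)%:P)`_k =
    ((val A 1 0)%:P * ('X * 'X) + 'X * (val A 1 1)%:P)`_k by exact: E.
have := (coef_eq 0%N, coef_eq 1%N, coef_eq 2%N).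
rewrite !(coefD, coefCM, coefXM, coefX, coefC) /= !(mulr0, mulr1, add0r, addr0).
case=> [[b0 ad] /esym c0].
apply/eqP/pglP; exists (val A 0 0).
  by have := GL2_det_neq0 A; rewrite b0 mul0r subr0 mulf_eq0 => /norP[].
apply/matrixP => i j; rewrite !mxE.
have ord2 (k : 'I_2) : k = 0 \/ k = 1.
  by case: k => [[|[|]]] // k_lt; [left|right]; apply/val_inj.
by case: (ord2 i) (ord2 j) => -> [] ->; rewrite ?mulr1 ?mulr0.
Qed.

(** Right translation by the inverse of t reduces the injectivity to the case of
    the identity, where it is [lft_eq_var]. *)
Lemma lft_inj : injective (@lft F).
Proof.
move=> s t st; have [Phi [_ Phi_var Phi_lft]] := substitution_lft_exists t^-1%g.
have lft1 : lft (1%g : PGL2 F) = var.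
  rewrite (@lftE F (gl_one F)) mx_lftE !mxE /= !rmorph1 !rmorph0.
  by rewrite mul1r mul0r addr0 add0r divr1.
have : Phi (lft s) = var by rewrite st Phi_lft mulgV lft1.
by rewrite Phi_lft => /lft_eq_var /(congr1 (fun u => u * t)%g); rewrite mulgVK mul1g.
Qed.

(** * Orbit polynomials under endomorphisms of F(x) *)

(** Both kinds of endomorphisms act on the set of all s(x) through a map h of
    PGL(2,F) into itself: a right translation for a substitution, and the action
    s |-> sigma.s for an endomorphism of F.  Such an h inherits injectivity from
    the endomorphism, so the factors of P_G stay distinct. *)
Lemma orbit_poly_map (psi : {rmorphism Fx -> Fx}) (h : PGL2 F -> PGL2 F)
    (G : {fset PGL2 F}) : (forall s, psi (lft s) = lft (h s)) ->
  injective h /\ map_poly psi (orbit_poly G) = orbit_poly [fset h s | s in G]%fset.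
Proof.
move=> psi_lft.
have h_inj : injective h.
  by move=> s t st; apply/lft_inj/(fmorph_inj psi); rewrite !psi_lft st.
split=> //; rewrite /orbit_poly rmorph_prod big_imfset /=; last by move=> s t _ _ /h_inj.
by apply: eq_bigr => s _; rewrite rmorphB /= map_polyX map_polyC /= psi_lft.
Qed.

Lemma right_translate_group (G : {fset PGL2 F}) t :
  group_closed [in G] -> t \in G -> [fset s * t | s in G]%fset%g = G.
Proof.
move=> G_group tG; apply/eqP; rewrite eqEfcard; apply/andP; split.
  apply/fsubsetP => u /imfsetP[s /= sG ->].
  exact: (group_closedM G_group).
by rewrite card_imfset //; apply: mulIg.
Qed.

(** * The degree of a coefficient of the orbit polynomial *)

(** All coefficients of the product share the denominator q, the product of the
    c_s x + d_s; multiplying by it replaces each factor T - s(x) by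
    (c_s x + d_s) T - (a_s x + b_s), which has degree at most 1 in x.  The
    statement is about sequences for the sake of induction. *)
Lemma orbit_poly_coef_frac (r : seq (PGL2 F)) (i : nat) :
  exists p q : {poly F}, [/\ (size p <= (size r).+1)%N, (size q <= (size r).+1)%N,
    q != 0 & (\prod_(s <- r) ('X - (lft s)%:P))`_i = tofrac p / tofrac q].
Proof.
pose num (s : PGL2 F) := (val (repr s) 0 0)%:P * 'X + (val (repr s) 0 1)%:P.
pose den (s : PGL2 F) := (val (repr s) 1 0)%:P * 'X + (val (repr s) 1 1)%:P.
have den0 s : den s != 0.
  by rewrite -tofrac_eq0 tofracD tofracM; apply: den_neq0.
have size_le2 (a b : F) : (size (a%:P * 'X + b%:P)%R <= 2)%N.
  by rewrite size_MXaddC; case: ifP => // _; rewrite ltnS size_polyC_leq1.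
have size_mul (u v : {poly F}) n :
    (size u <= 2)%N -> (size v <= n.+1)%N -> (size (u * v)%R <= n.+2)%N.
  move=> u2 vn; apply: leq_trans (size_polyMleq _ _) _.
  by rewrite -subn1 leq_subLR (leq_trans (leq_add u2 vn)).
suff [q [q0 qn E]] : exists q : {poly F}, [/\ q != 0, (size q <= (size r).+1)%N
    & forall k, exists2 p : {poly F}, (size p <= (size r).+1)%N
      & (\prod_(s <- r) ('X - (lft s)%:P))`_k * tofrac q = tofrac p].
  have [p pn pE] := E i; exists p, q; split=> //.
  by rewrite -pE mulfK // tofrac_eq0.
elim: r => [|s r [q [q0 qn E]]].
  exists 1; rewrite oner_eq0 size_poly1; split=> // k; rewrite big_nil coef1.
  exists (k == 0%N)%:R; first by rewrite -polyC_natr size_polyC_leq1.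
  by rewrite mulr1 rmorph_nat.
exists (den s * q); split=> [||k]; first by rewrite mulf_neq0.
  exact: size_mul (size_le2 _ _) qn.
rewrite big_cons mulrBl coefB coefXM coefCM.
have [p pn pE] := E k; have [p' p'n p'E] := E k.-1.
(* For k = 0 the term T * P does not contribute, and p', the numerator for the
   index k.-1 = 0, has to be discarded. *)
exists ((if k == 0%N then 0 else den s * p') - num s * p).
  rewrite (leq_trans (size_polyD _ _)) // geq_max size_polyN.
  by rewrite (size_mul _ _ _ (size_le2 _ _) pn) andbT; case: ifP => _;
    rewrite ?size_poly0 ?(size_mul _ _ _ (size_le2 _ _) p'n).
rewrite tofracM mulrBl tofracB tofracM -pE; congr (_ - _).
  case: ifP => _; first by rewrite mul0r tofrac0.
  by rewrite tofracM -p'E mulrCA.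
have den_s0 : tofrac (den s) != 0 by rewrite tofrac_eq0.
rewrite -/(num s) {1}/lft /mx_lft -/(num s) -/(den s).
by rewrite mulrACA divfK // [in RHS]mulrA.
Qed.

(** Since f / g is in lowest terms, f and g divide the numerator and the denominator
    given by [orbit_poly_coef_frac]. *)
Lemma orbit_coef_size (G : {fset PGL2 F}) i (f g : {poly F}) :
  coprimep f g -> g != 0 -> (orbit_poly G)`_i = tofrac f / tofrac g -> f != 0 ->
  (size f <= #|` G|.+1)%N /\ (size g <= #|` G|.+1)%N.
Proof.
move=> fg_coprime g0 fgE f0; have [p [q [pn qn q0]]] := orbit_poly_coef_frac G i.
rewrite -/(orbit_poly G) fgE => /eqP.
rewrite eqr_div ?tofrac_eq0 // -!tofracM tofrac_eq => /eqP fq_pg.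
have p0 : p != 0.
  apply: contra_neq f0 => p0; apply: (mulIf q0).
  by rewrite fq_pg p0 !mul0r.
split.
  apply: leq_trans pn; apply: dvdp_leq => //.
  by rewrite -(Gauss_dvdpl _ fg_coprime) -fq_pg dvdp_mulr.
apply: leq_trans qn; apply: dvdp_leq => //; rewrite coprimep_sym in fg_coprime.
by rewrite -(Gauss_dvdpr _ fg_coprime) fq_pg dvdp_mull.
Qed.

(** * The group as the root set of a polynomial *)

(** Right translation by s in G permutes G, so the substitution of s(x) for x
    fixes the coefficients of P_G. *)
Lemma horner_lft_mem (G : {fset PGL2 F}) i (f g : {poly F}) (s : PGL2 F) :
  group_closed [in G] -> g != 0 -> (orbit_poly G)`_i = tofrac f / tofrac g ->
  s \in G ->
  (map_poly cst f).[lft s] = (orbit_poly G)`_i * (map_poly cst g).[lft s].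
Proof.
move=> G_group g0 fgE sG.
have [Phi [Phi_cst Phi_var Phi_lft]] := substitution_lft_exists s.
have Phi_poly (p : {poly F}) : Phi (tofrac p) = (map_poly cst p).[lft s].
  rewrite -horner_cst_var -horner_map Phi_var -map_poly_comp; congr (_.[_]).
  by apply: eq_map_poly => c; apply: Phi_cst.
have [_] := orbit_poly_map G Phi_lft.
rewrite right_translate_group // => /(congr1 (fun P : {poly Fx} => P`_i)).
rewrite coef_map => Phi_coef; rewrite -!Phi_poly -{}Phi_coef fgE.
by rewrite -rmorphM divfK // tofrac_eq0.
Qed.

(** The polynomial R = f - u g over F(x) has degree at most #|G| and already has
    the s(x), for s in G, as roots: there is no room for another t(x). *)
Lemma mem_of_horner_lft (G : {fset PGL2 F}) i (f g : {poly F}) (t : PGL2 F) :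
  group_closed [in G] -> coprimep f g -> g != 0 ->
  (orbit_poly G)`_i = tofrac f / tofrac g ->
  ~ (exists c : F, (orbit_poly G)`_i = tofrac c%:P) ->
  (map_poly cst f).[lft t] = (orbit_poly G)`_i * (map_poly cst g).[lft t] ->
  t \in G.
Proof.
move=> G_group fg_coprime g0 fgE nonconst t_root.
have f0 : f != 0.
  apply/eqP => f0; apply: nonconst; exists 0.
  by rewrite fgE f0 tofrac0 mul0r.
have [f_size g_size] := orbit_coef_size fg_coprime g0 fgE f0.
set u := (orbit_poly G)`_i in fgE nonconst t_root *.
pose R := map_poly cst f - u *: map_poly cst g.
(* If R = 0, comparing the coefficients at the degree of g gives the constant
   value of u. *)
have R0 : R != 0.
  apply/eqP => /polyP /(_ (size g).-1); rewrite coefB coefZ !coef_map coef0.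
  rewrite -/(lead_coef g) => /subr0_eq lead_eq.
  apply: nonconst; exists (f`_(size g).-1 / lead_coef g).
  have lead0 : cst (lead_coef g) != 0 by rewrite fmorph_eq0 lead_coef_eq0.
  by rewrite -[tofrac _]/(cst _) fmorph_div lead_eq mulfK.
have R_size : (size R <= #|` G|.+1)%N.
  rewrite (leq_trans (size_polyD _ _)) // geq_max size_polyN size_map_poly f_size.
  by rewrite (leq_trans (size_scale_leq _ _)) // size_map_poly.
apply/negPn/negP => tG.
have : (size [seq lft s | s <- t :: G] < size R)%N.
  apply: max_poly_roots => //; last first.
    by rewrite map_inj_uniq /= ?tG ?fset_uniq //; exact: lft_inj.
  apply/allP => y /mapP[s sG ->]; rewrite /root hornerD hornerN hornerZ subr_eq0.
  move: sG; rewrite inE => /predU1P[->|sG]; first by rewrite t_root.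
  by rewrite (horner_lft_mem G_group g0 fgE sG).
by rewrite size_map /= ltnNge R_size.
Qed.

(** * The action of an endomorphism of F *)

(** By coprimality f divides sigma(f), which is monic of the same degree; the
    equation then determines sigma(g).  The lemma also serves with f and g
    exchanged. *)
Lemma map_poly_fixed_of_cross (f g : {poly F}) (sigma : {rmorphism F -> F}) :
  coprimep f g -> f \is monic ->
  map_poly sigma f * g = map_poly sigma g * f ->
  map_poly sigma f = f /\ map_poly sigma g = g.
Proof.
move=> fg_coprime f_monic cross.
have f_eq : map_poly sigma f = f.
  have f_dvd : f %| map_poly sigma f.
    by rewrite -(Gauss_dvdpl _ fg_coprime) cross dvdp_mull.
  have : f %= map_poly sigma f by rewrite -(dvdp_size_eqp f_dvd) size_map_poly.
  by rewrite eqp_monic ?map_monic // => /eqP.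
split=> //; apply/esym/(mulfI (monic_neq0 f_monic)).
by rewrite -{1}f_eq cross mulrC.
Qed.

Lemma pgl_map_action (sigma : {rmorphism F -> F}) (Psi : {rmorphism Fx -> Fx}) :
  (forall p, Psi (tofrac p) = tofrac (map_poly sigma p)) ->
  forall s, Psi (lft s) = lft (pgl_map sigma s).
Proof.
move=> PsiE s; rewrite /pgl_map lftE /lft /mx_lft fmorph_div !PsiE !rmorphD.
by rewrite !rmorphM /= !map_polyC map_polyX !mxE.
Qed.

End RationalFunctions.

Theorem lemma33 (F : fieldType) (G : {fset PGL2 F})
    (G_group : group_closed [in G])
    (G_minimal : forall K : {pred F}, GRing.divring_closed K ->
       (exists a, a \notin K) -> ~ defined_over K G)
    (f g : {poly F}) (fg_coprime : coprimep f g)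
    (fg_monic : f \is monic \/ g \is monic)
    (i : nat) (fg_coef : (orbit_poly G)`_i = tofrac f / tofrac g)
    (fg_nonconstant : ~ exists c : F, (orbit_poly G)`_i = tofrac c%:P)
    (H : set {rmorphism F -> F}) (H_group : finite_autgroup H)
    (H_nontrivial : exists2 sigma : {rmorphism F -> F}, H sigma & ~ (sigma =1 id)) :
  autgroup_fixes H G <->
  (f \is a polyOver (fixed_field H) /\ g \is a polyOver (fixed_field H)).
Proof.
have g0 : g != 0.
  apply/eqP => g0; apply: fg_nonconstant; exists 0.
  by rewrite fg_coef g0 tofrac0 invr0 mulr0.
(* The coefficients beyond the degree of p are 0, which every sigma fixes. *)
have fixedP (p : {poly F}) : p \is a polyOver (fixed_field H) <->
    forall sigma, H sigma -> map_poly sigma p = p.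
  rewrite qualifE /=; split=> [/allP pH sigma Hs | pH].
    apply/polyP => k; rewrite coef_map /=; have [k_lt | k_ge] := ltnP k (size p).
      by have /asboolP := pH _ (mem_nth 0 k_lt); apply.
    by rewrite nth_default // rmorph0.
  apply/(all_nthP 0) => k _; apply/asboolP => sigma Hs.
  by rewrite -[in RHS](pH _ Hs) coef_map.
split=> [H_fixes | [/fixedP f_fix /fixedP g_fix] sigma Hs].
  suff fg_fix sigma : H sigma -> map_poly sigma f = f /\ map_poly sigma g = g.
    by split; apply/fixedP => sigma /fg_fix[].
  move=> Hs; have [Psi PsiE] := coef_action_exists sigma.
  have [_] := orbit_poly_map G (pgl_map_action PsiE).
  rewrite H_fixes // => /(congr1 (fun P : {poly {fraction {poly F}}} => P`_i)).
  rewrite coef_map fg_coef /= fmorph_div !PsiE => /eqP.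
  rewrite eqr_div ?tofrac_eq0 ?map_poly_eq0 // -!tofracM tofrac_eq.
  rewrite [f * _]mulrC => /eqP cross.
  case: fg_monic => [f_monic|g_monic]; first exact: map_poly_fixed_of_cross.
  rewrite coprimep_sym in fg_coprime.
  by have [] := map_poly_fixed_of_cross fg_coprime g_monic (esym cross).
have [Psi PsiE] := coef_action_exists sigma.
have [sigma_inj _] := orbit_poly_map G (pgl_map_action PsiE).
apply/eqP; rewrite eqEfcard card_imfset //= leqnn andbT.
apply/fsubsetP => t /imfsetP[s /= sG ->].
apply: (mem_of_horner_lft G_group fg_coprime g0 fg_coef fg_nonconstant).
have Psi_horner (p : {poly F}) : map_poly sigma p = p ->
    Psi (map_poly (@cst F) p).[lft s] = (map_poly (@cst F) p).[lft (pgl_map sigma s)].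
  move=> p_fix; rewrite -horner_map (pgl_map_action PsiE); congr (_.[_]).
  rewrite -[in RHS]p_fix -!map_poly_comp; apply: eq_map_poly => c.
  by rewrite /= PsiE map_polyC.
have := congr1 Psi (horner_lft_mem G_group g0 fg_coef sG).
by rewrite rmorphM !Psi_horner ?f_fix ?g_fix // fg_coef fmorph_div !PsiE f_fix ?g_fix.
Qed.
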